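(* Let $\mathcal{K}\hookrightarrow\mathcal{L}$ be an inclusion of finite simplicial complexes, where $\mathcal{L}$ is a $(q+1)$-dimensional orientable pseudomanifold with boundary whose dual graph is connected, and assume $C_{q+1}^{\mathcal{L},\mathcal{K}}\ne0$. Let $G=(V,E)$ be the dual graph of $\mathcal{K}\subset\mathcal{L}$, with ground vertex $u$. Then $$\varphi_q^{\mathcal{K},\mathcal{L}}=\min_{i\in V\setminus\{u\}}\frac{1}{\operatorname{dist}(i,u)}.$$
   Context: **Chains.** $S_q^{\mathcal{X}}$ is the set of $q$-simplices of $\mathcal{X}$ and $C_q^{\mathcal{X}}$ the real $q$-chains with the inner product making oriented $q$-simplices orthonormal; $B_{q+1}^{\mathcal{L}}$ is the matrix of $\partial_{q+1}^{\mathcal{L}}$. $C_{q+1}^{\mathcal{L},\mathcal{K}}=\{c\in C_{q+1}^{\mathcal{L}}:\partial_{q+1}^{\mathcal{L}}c\in C_q^{\mathcal{K}}\}$. **Pseudomanifolds.** $\mathcal{L}$ of dimension $q+1$ is an orientable pseudomanifold if every $q$-simplex is a face of at most two $(q+1)$-simplices and the $(q+1)$-simplices can be oriented so as to induce opposite orientations on shared $q$-faces; such orientations are fixed. With boundary: some $q$-simplex is a face of exactly one $(q+1)$-simplex. The dual graph of $\mathcal{L}$ has the $(q+1)$-simplices as vertices and edges between those sharing a $q$-face. **Dual graph $G$ of the inclusion, with ground vertex.** $C_{q+1}^{\mathcal{L},\mathcal{K}}$ has a basis $c_1,\dots,c_m$ (known to exist, unique up to order) of $0/1$ indicator chains with pairwise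 disjoint supports. Let $B_{q+1}^{\mathcal{L},\mathcal{K}}$ be the matrix, with rows indexed by $S_q^{\mathcal{K}}$ and columns by $c_1,\dots,c_m$, of the boundary operator restricted to $C_{q+1}^{\mathcal{L},\mathcal{K}}$. Each row has entries in $\{0,\pm1\}$, with at most two nonzero entries, and if there are two they have opposite signs. $G$ is the (multi)graph with vertex set $V=\{1,\dots,m\}\cup\{u\}$ having one edge for each nonzero row: it joins $i$ and $j$ if the row is nonzero exactly at $i,j$, and joins $i$ and $u$ if the row is nonzero only at $i$. (Thus $(B_{q+1}^{\mathcal{L},\mathcal{K}})^T$ is, up to zero columns, the incidence matrix of $G$ with the row of $u$ deleted.) $\operatorname{dist}$ is the shortest-path distance in $G$. **Cheeger constant.** Let $B$ be the submatrix of $B_{q+1}^{\mathcal{L}}$ of rows indexed by $S_q^{\mathcal{K}}$, and $P$ the orthogonal projection of $C_{q+1}^{\mathcal{L}}$ onto $C_{q+1}^{\mathcal{L},\mathcal{K}}$. Then $$\varphi_q^{\mathcal{K},\mathcal{L}}=\min_{\substack{0\ne x\in C_q^{\mathcal{K}}\\ x\perp^1\ker(PB^T)}}\frac{\|PB^Tx\|_1}{\|x\|_1},$$ where $x\perp^1Y$ means $\|x+y\|_1\ge\|x\|_1$ for all $y\in Y$. *)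

(* Defs.v *)
From mathcomp Require Import all_classical reals.
From mathcomp Require Import all_boot all_order all_algebra.

Set Implicit Arguments.
Unset Strict Implicit.
Unset Printing Implicit Defensive.

Import Order.TTheory GRing.Theory Num.Theory.

Local Open Scope ring_scope.

Definition is_minimum (R : realType) (A : set R) (a : R) : Prop :=
  (A a /\ lbound A a)%classic.

(** * Simplicial complexes and oriented boundary operators *)

Section Complexes.
Variable V : finType.
Implicit Types (K L A B : {set {set V}}) (s t : {set V}).

(* Simplices are nonempty sets of vertices. *)
Definition simplicial_complex K : Prop :=
  set0 \notin K /\
  forall s t, s \in K -> t \subset s -> t != set0 -> t \in K.

(* A q-simplex has q + 1 vertices. *)
Definition simplices K (q : nat) : {set {set V}} := [set s in K | #|s| == q.+1].

Definition has_dim K (q : nat) : Prop :=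
  simplices K q != set0 /\ forall s, s \in K -> (#|s| <= q.+1)%N.

(* [enum t] lists the vertices of t in the fixed enumeration order of V, which
   gives t a reference orientation; [o t] says whether t is given the opposite
   one.  For such ordered simplices
     d [v_0, .., v_k] = \sum_j (-1)^j [v_0, .., v_(j-1), v_(j+1), .., v_k],
   so the coefficient of s in the boundary of t is the number below.  The sum
   has at most one term, and is 0 when s is not a facet of t. *)
Definition incidence (o : {set V} -> bool) s t : int :=
  \sum_(v in t | s == t :\ v) (-1) ^+ (o s + o t + index v (enum t))%N.

(* Rows are indexed by A, columns by B, through [enum_val]. *)
Definition bdmx (R : realType) (o : {set V} -> bool) A B : 'M[R]_(#|A|, #|B|) :=
  \matrix_(i < #|A|, j < #|B|) (incidence o (enum_val i) (enum_val j))%:~R.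

Definition cofaces L (q : nat) s : {set {set V}} :=
  [set t in simplices L q.+1 | s \subset t].

(* Distinct (q+1)-simplices of L induce opposite orientations on a shared
   q-face; the orientation of the q-simplices themselves is arbitrary. *)
Definition coherent_orientation (o : {set V} -> bool) L (q : nat) : Prop :=
  forall s t t', s \in simplices L q ->
    t \in cofaces L q s -> t' \in cofaces L q s -> t != t' ->
    incidence o s t = - incidence o s t'.

Definition orientable_pseudomanifold L (q : nat) : Prop :=
  [/\ has_dim L q.+1,
      forall s, s \in simplices L q -> (#|cofaces L q s| <= 2)%N
    & exists o, coherent_orientation o L q].

Definition with_boundary L (q : nat) : Prop :=
  exists2 s, s \in simplices L q & #|cofaces L q s| = 1%N.

Definition dual_adj L (q : nat) : rel {set V} :=
  [rel t t' | [&& t \in simplices L q.+1, t' \in simplices L q.+1, t != t'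
    & [exists s in simplices L q, (s \subset t) && (s \subset t')]]].

Definition dual_connected L (q : nat) : Prop :=
  {in simplices L q.+1 &, forall t t', connect (dual_adj L q) t t'}.

End Complexes.

(** * Relative chains and the Cheeger constant *)

(* Real q-chains of K are row vectors indexed by [simplices K q], i.e.
   coordinates in the orthonormal basis of o-oriented simplices.  As MathComp
   matrices act on row vectors from the right, the boundary of a chain c is
   [c *m B^T] for B the matrix of the boundary operator, and B^T x is
   [x *m B]. *)

Section RelativeChains.
Variables (R : realType) (V : finType) (o : {set V} -> bool).
Variables (K L : {set {set V}}) (q : nat).

Definition bdL : 'M[R]_(#|simplices L q|, #|simplices L q.+1|) :=
  bdmx R o (simplices L q) (simplices L q.+1).

Definition bdLK : 'M[R]_(#|simplices K q|, #|simplices L q.+1|) :=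
  bdmx R o (simplices K q) (simplices L q.+1).

(* The inclusion of the q-chains of K into those of L. *)
Definition chain_incl : 'M[R]_(#|simplices K q|, #|simplices L q|) :=
  \matrix_(i, j) (enum_val i == enum_val j)%:R.

(* The row space of this matrix is the space of (q+1)-chains c of L whose
   boundary lies in the image of [chain_incl]; see [rel_chainsP]. *)
Definition rel_chains : 'M[R]_#|simplices L q.+1| :=
  kermx (bdL^T *m cokermx chain_incl).

Lemma rel_chainsP (c : 'rV[R]_#|simplices L q.+1|) :
  (c <= rel_chains)%MS = (c *m bdL^T <= chain_incl)%MS.
Proof. by rewrite /rel_chains sub_kermx mulmxA submxE. Qed.

(* [kermx rel_chains^T] is the orthogonal complement of [rel_chains]. *)
Definition rel_proj : 'M[R]_#|simplices L q.+1| :=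
  proj_mx rel_chains (kermx rel_chains^T).

Definition norm1 (n : nat) (x : 'rV[R]_n) : R := \sum_j `|x 0 j|.

Definition perp1 (m n : nat) (x : 'rV[R]_n) (Y : 'M[R]_(m, n)) : Prop :=
  forall y : 'rV[R]_n, (y <= Y)%MS -> norm1 x <= norm1 (x + y).

(* The operator x |-> P B^T x. *)
Definition PBt : 'M[R]_(#|simplices K q|, #|simplices L q.+1|) :=
  bdLK *m rel_proj.

Definition cheeger_quotients : set R :=
  [set norm1 (x *m PBt) / norm1 x
    | x in [set x : 'rV[R]_#|simplices K q| | x != 0 /\ perp1 x (kermx PBt)]]%classic.

(* The minimum of the quotients is their infimum when it is attained. *)
Definition cheeger : R := inf cheeger_quotients.

(** * The dual graph of the inclusion *)

(* The rows of c are the chains c_1, .., c_m. *)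
Definition indicator_basis (m : nat) (c : 'M[R]_(m, #|simplices L q.+1|)) : Prop :=
  [/\ (c == rel_chains)%MS, row_free c,
      forall i j, c i j = 0 \/ c i j = 1
    & forall i i' j, i != i' -> c i j = 0 \/ c i' j = 0].

(* The i-th column holds the coordinates, on the q-simplices of K, of the
   boundary of c_i. *)
Definition rel_bd (m : nat) (c : 'M[R]_(m, #|simplices L q.+1|)) :
    'M[R]_(#|simplices K q|, m) :=
  bdLK *m c^T.

End RelativeChains.

Arguments cheeger_quotients R {V} o K L q.

(* The vertices of G are [Some i] for the basis chains and [None] for the
   ground vertex; the edges are the nonzero rows of D, and [edge_joins D r x y]
   says that the edge given by row r has endpoints x and y (so row r is
   nonzero). *)
Definition edge_joins (R : realType) (k m : nat) (D : 'M[R]_(k, m)) (r : 'I_k)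
    (x y : option 'I_m) : bool :=
  let supp := [set i | D r i != 0]%SET in
  match x, y with
  | Some i, Some j => (i != j) && (supp == [set i; j]%SET)
  | Some i, None | None, Some i => supp == [set i]%SET
  | None, None => false
  end.

Definition graph_adj (R : realType) (k m : nat) (D : 'M[R]_(k, m)) :
    rel (option 'I_m) :=
  [rel x y | [exists r, edge_joins D r x y]].

Definition walk (T : finType) (e : rel T) (x y : T) (n : nat) : bool :=
  [exists p : n.-tuple T, path e x p && (last x p == y)].

(* The length of a shortest walk.  When there is none the value is 0, so that
   the inverse of the distance is then 0 in R, in agreement with 1/oo = 0. *)
Definition graph_dist (T : finType) (e : rel T) (x y : T) : nat :=
  match pselect (exists n, walk e x y n) with
  | left h => ex_minn h
  | right _ => 0%N
  end.

(* Main.v *)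
Require Import Defs.
From mathcomp Require Import all_classical reals.
From mathcomp Require Import all_boot all_order all_algebra.

(** Since P averages over the supports of the c_i, the numerator ||P B^T x||_1
is the 1-norm of the divergence x D of the flow x on G, where D = B^{L,K} is
the incidence matrix of G with the ground vertex deleted, and perp1 says that
x is a cheapest flow with its divergence.  The cheapest flow from i to u costs
exactly dist(i, u): a shortest path gives the upper bound, and the potential
dist(_, u), which is 1-Lipschitz along edges, the lower bound.  By linearity a
cheapest flow of divergence f costs at most (max_i dist(i, u)) ||f||_1, with
equality at a unit flow from a farthest vertex.  Every i is connected to u,
as otherwise some of the c_i would sum to a cycle of L, and a connected
pseudomanifold with boundary has none in top dimension. *)

Set Implicit Arguments.
Unset Strict Implicit.
Unset Printing Implicit Defensive.

Import Order.TTheory GRing.Theory Num.Theory.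

Local Open Scope ring_scope.

(** * Shortest walks in a finite graph *)

Section GraphDistance.
Context {T : finType} (e : rel T).
Implicit Types x y : T.

Lemma walkP x y n :
  reflect (exists p, [/\ path e x p, last x p = y & size p = n])
    (walk e x y n).
Proof.
apply: (iffP existsP) => [[p /andP[ep /eqP lp]]|[p [ep lp sp]]].
  by exists p; rewrite size_tuple.
by exists (tcast sp (in_tuple p)); rewrite val_tcast /= ep lp eqxx.
Qed.

Lemma graph_dist_le x y n : walk e x y n -> (graph_dist e x y <= n)%N.
Proof.
rewrite /graph_dist => wn; case: pselect => [h|//].
by case: ex_minnP => k _; apply.
Qed.

Lemma graph_dist_walk x y : connect e x y -> walk e x y (graph_dist e x y).
Proof.
move=> /connectP[p ep lp]; rewrite /graph_dist; case: pselect => [h|nh].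
  by case: ex_minnP.
by case: nh; exists (size p); apply/walkP; exists p.
Qed.

Lemma graph_dist_refl x : graph_dist e x x = 0%N.
Proof. by apply/eqP; rewrite -leqn0; apply/graph_dist_le/walkP; exists nil. Qed.

Lemma graph_dist_step x x' y : e x x' -> connect e x' y ->
  (graph_dist e x y <= (graph_dist e x' y).+1)%N.
Proof.
move=> exx' /graph_dist_walk/walkP[p [ep lp sp]].
by apply/graph_dist_le/walkP; exists (x' :: p); rewrite /= exx' ep lp sp.
Qed.

End GraphDistance.

Lemma mulmx_entry (R : pzSemiRingType) m n p (A : 'M[R]_(m, n))
    (B : 'M[R]_(n, p)) i j :
  (A *m B) i j = (row i A *m B) 0 j.
Proof. by rewrite -row_mul [RHS]mxE. Qed.

(** * The 1-norm on row vectors *)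

Section Norm1.
Context {R : realType}.

Lemma norm1_ge0 n (x : 'rV[R]_n) : 0 <= norm1 x.
Proof. exact: sumr_ge0. Qed.

Lemma norm1_eq0 n (x : 'rV[R]_n) : (norm1 x == 0) = (x == 0).
Proof.
rewrite psumr_eq0//; apply/allP/eqP => [x0|-> j _]; last first.
  by rewrite mxE normr0 eqxx.
apply/rowP => j; rewrite mxE; apply/eqP; rewrite -normr_eq0.
exact: x0 (mem_index_enum j).
Qed.

Lemma norm1D n (x y : 'rV[R]_n) : norm1 (x + y) <= norm1 x + norm1 y.
Proof. by rewrite -big_split ler_sum// => j _; rewrite mxE ler_normD. Qed.

Lemma norm1Z n a (x : 'rV[R]_n) : norm1 (a *: x) = `|a| * norm1 x.
Proof. by rewrite mulr_sumr; apply: eq_bigr => j _; rewrite mxE normrM. Qed.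

Lemma norm1_sum n I (r : seq I) (x : I -> 'rV[R]_n) :
  norm1 (\sum_(i <- r) x i) <= \sum_(i <- r) norm1 (x i).
Proof.
elim/big_rec2: _ => [|i a y _ le_ya]; last first.
  by rewrite (le_trans (norm1D _ _))// lerD2l.
by rewrite le_eqVlt norm1_eq0 eqxx.
Qed.

Lemma norm1_delta n (i : 'I_n) : norm1 (delta_mx 0 i : 'rV[R]_n) = 1.
Proof.
rewrite /norm1 (bigD1 i)//= big1 => [|j ji].
  by rewrite mxE !eqxx normr1 addr0.
by rewrite mxE eqxx (negPf ji) normr0.
Qed.

Lemma ler_norm_mul_col n (x : 'rV[R]_n) (z : 'cV[R]_n) :
  (forall r, `|z r 0| <= 1) -> `|(x *m z) 0 0| <= norm1 x.
Proof.
move=> z1; rewrite mxE (le_trans (ler_norm_sum _ _ _))// ler_sum// => j _.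
by rewrite normrM ler_piMr.
Qed.

End Norm1.

(** * Incidence matrices with the row of the ground vertex deleted *)

Section GroundedIncidence.
Context {R : realType} {k m : nat}.
Implicit Types D : 'M[R]_(k, m).

(* Three nonzero entries in a row would be pairwise opposite, so a row has at
   most two. *)
Definition grounded_incidence D : Prop :=
  (forall r i, D r i != 0 -> `|D r i| = 1) /\
  (forall r i j, i != j -> D r i != 0 -> D r j != 0 -> D r i = - D r j).

Definition grounded (z : 'cV[R]_m) (x : option 'I_m) : R :=
  if x is Some i then z i 0 else 0.

Definition vertex_chain (x : option 'I_m) : 'rV[R]_m :=
  if x is Some i then delta_mx 0 i else 0.

Lemma vertex_chain_mul x (z : 'cV[R]_m) :
  (vertex_chain x *m z) 0 0 = grounded z x.
Proof. by case: x => [i|] /=; rewrite ?mul0mx -?rowE !mxE. Qed.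

Lemma edge_joins_sym D r x y : edge_joins D r x y = edge_joins D r y x.
Proof. by case: x y => [i|] [j|] //=; rewrite eq_sym finset.setUC. Qed.

(** The ground vertex has chain 0, so edges between two basis vertices and edges to the ground get
    one formula. The sign [a] absorbs the orientation of the edge and the order of its endpoints. *)
Lemma edge_row D r x y : grounded_incidence D -> edge_joins D r x y ->
  exists2 a, `|a| = 1 & row r D = a *: (vertex_chain x - vertex_chain y).
Proof.
move=> [D1 DN].
wlog [i ->] : x y / exists i, x = Some i.
  move=> wl; case: x => [i|]; first by apply: wl; exists i.
  case: y => [i|//]; rewrite edge_joins_sym => /wl[|a a1 ->]; first by exists i.
  by exists (- a); rewrite ?normrN// scaleNr -scalerN opprB.
have suppE (A : {set 'I_m}) : [set i | D r i != 0]%SET == A ->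
    forall j, (D r j == 0) = (j \notin A).
  by move=> /eqP <- j; rewrite inE negbK.
case: y => [j|] /= => [/andP[ij]|] /suppE sA; exists (D r i).
- by apply: D1; rewrite sA !inE eqxx.
- have Dij : D r j = - D r i.
    by apply: DN; rewrite ?sA ?inE ?eqxx ?orbT// eq_sym.
  apply/rowP => l; rewrite !mxE eqxx /=.
  have [->|li] := eqVneq l i; first by rewrite (negPf ij) subr0 mulr1.
  have [->|lj] := eqVneq l j; first by rewrite sub0r mulrN1.
  by rewrite subr0 mulr0; apply/eqP; rewrite sA !inE negb_or li.
- by apply: D1; rewrite sA !inE eqxx.
- apply/rowP => l; rewrite !mxE eqxx subr0 /=.
  have [->|li] := eqVneq l i; first by rewrite mulr1.
  by rewrite mulr0; apply/eqP; rewrite sA !inE.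
Qed.

Lemma edge_support D r i j : grounded_incidence D -> i != j ->
  D r i != 0 -> D r j != 0 -> [set l | D r l != 0]%SET == [set i; j]%SET.
Proof.
move=> [_ DN] ij Di Dj; apply/eqP/setP => l; rewrite !inE.
have [->|li] := eqVneq l i; first by rewrite Di.
have [->|lj] := eqVneq l j; first by rewrite Dj.
apply/negbTE; rewrite negbK; apply: contraT => Dl.
have := DN r _ _ li Dl Di; rewrite (DN r _ _ lj Dl Dj).
move/oppr_inj => Dji; have := DN r _ _ ij Di Dj; rewrite Dji => /eqP.
by rewrite -addr_eq0 -mulr2n mulrn_eq0 (negPf Di).
Qed.

Lemma row_edge D r : grounded_incidence D ->
  row r D = 0 \/ exists x y, edge_joins D r x y.
Proof.
move=> gD; have [/existsP[i Di]|/existsPn D0] := boolP [exists i, D r i != 0];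
  last first.
  by left; apply/rowP => i; rewrite !mxE; exact/eqP/negPn/D0.
right; have [/existsP[j /andP[ij Dj]]|/existsPn Dj] :=
  boolP [exists j, (i != j) && (D r j != 0)].
  by exists (Some i), (Some j); rewrite /= ij edge_support.
exists (Some i), None; apply/eqP/setP => l; rewrite !inE.
have [->|li] := eqVneq l i; first by rewrite Di.
by have := Dj l; rewrite eq_sym li /= => /negPf.
Qed.

Lemma edge_mul D r x y (z : 'cV[R]_m) :
  grounded_incidence D -> edge_joins D r x y ->
  exists2 a, `|a| = 1 & (D *m z) r 0 = a * (grounded z x - grounded z y).
Proof.
move=> gD /(edge_row gD)[a a1 Da]; exists a => //.
rewrite mulmx_entry Da -scalemxAl mulmxBl -!vertex_chain_mul.
by rewrite mxE [X in _ * X]mxE [X in _ + X]mxE.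
Qed.

Lemma edge_mul0 D r x y (z : 'cV[R]_m) :
  grounded_incidence D -> D *m z = 0 -> edge_joins D r x y ->
  grounded z x = grounded z y.
Proof.
move=> gD Dz /(edge_mul z gD)[a a1]; rewrite Dz mxE => /esym/eqP.
rewrite mulf_eq0 -normr_eq0 a1 oner_eq0 /= subr_eq0 => /eqP //.
Qed.

Lemma graph_adj_sym D x y : graph_adj D x y = graph_adj D y x.
Proof. by apply: eq_existsb => r; rewrite edge_joins_sym. Qed.

(** Push one unit along the path, edge by edge. The norm is only bounded, since a path may use an
    edge twice, with cancellation. The coefficient [a] of an edge works because [a * a = 1]. *)
Lemma flow_along_path D x p : grounded_incidence D ->
    path (graph_adj D) x p -> last x p = None ->
  exists2 y, y *m D = vertex_chain x & norm1 y <= (size p)%:R.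
Proof.
move=> gD; elim: p x => [|x' p IHp] x /= => [_ ->|/andP[/existsP[r]]].
  by exists 0; rewrite ?mul0mx// le_eqVlt norm1_eq0 eqxx.
move=> /(edge_row gD)[a a1 Da] /IHp/[apply] -[y yD ny].
have aa : a * a = 1 by rewrite -expr2 -real_normK ?num_real// a1 expr1n.
exists (a *: delta_mx 0 r + y).
  by rewrite mulmxDl -scalemxAl -rowE Da yD scalerA aa scale1r subrK.
rewrite (le_trans (norm1D _ _))// norm1Z a1 norm1_delta mulr1.
by rewrite -natr1 addrC lerD2r.
Qed.

End GroundedIncidence.

(** * Cheapest flows to the ground vertex *)

Section MinCostFlow.
Context {R : realType} {k m : nat} (D : 'M[R]_(k, m)).
Hypothesis D_grounded : grounded_incidence D.
Hypothesis D_connected : forall i, connect (graph_adj D) (Some i) None.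

Let dist (x : option 'I_m) : nat := graph_dist (graph_adj D) x None.

Lemma connect_ground x : connect (graph_adj D) x None.
Proof. by case: x. Qed.

(** Weak duality: pairing the flow [x] with [D *m h] gives the potential [h] at [i], while each
    entry of [D *m h] is, up to sign, a difference of distances across an edge, hence at most 1 in
    absolute value. *)
Lemma dist_le_norm1 (x : 'rV[R]_k) i :
  x *m D = delta_mx 0 i -> (dist (Some i))%:R <= norm1 x.
Proof.
move=> xD; pose h : 'cV[R]_m := \col_j (dist (Some j))%:R.
have hE y : grounded h y = (dist y)%:R.
  by case: y => [j|] /=; rewrite ?mxE// /dist graph_dist_refl.
have -> : (dist (Some i))%:R = `|(x *m (D *m h)) 0 0|.
  by rewrite mulmxA xD -rowE !mxE normr_nat.
apply: ler_norm_mul_col => r.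
have [Dr0|[y [y' yy']]] := row_edge r D_grounded.
  by rewrite mulmx_entry Dr0 mul0mx mxE normr0.
have [a a1 ->] := edge_mul h D_grounded yy'.
have Gyy' : graph_adj D y y' by apply/existsP; exists r.
have step := graph_dist_step Gyy' (connect_ground y').
have := Gyy'; rewrite graph_adj_sym => /graph_dist_step.
move=> /(_ _ (connect_ground y)) step'.
rewrite normrM a1 mul1r !hE ler_norml lerBrDr lerBlDr.
by rewrite [-1 + _]addrC lerBlDr natr1 nat1r !ler_nat step step'.
Qed.

Lemma unit_flow i :
  exists2 y, y *m D = delta_mx 0 i & norm1 y = (dist (Some i))%:R.
Proof.
have /graph_dist_walk/walkP[p [Gp lp sp]] := D_connected i.
have [y yD ny] := flow_along_path D_grounded Gp lp.
exists y => //; apply/eqP; rewrite eq_le dist_le_norm1// andbT.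
by rewrite (le_trans ny)// sp.
Qed.

Lemma dist_gt0 i : (0 < dist (Some i))%N.
Proof.
have /graph_dist_walk/walkP[p [_ lp sp]] := D_connected i.
by rewrite /dist -sp; case: p lp {sp}.
Qed.

(** The superposition [x'] of shortest-path flows, weighted by the divergence of [x], differs from
    [x] by an element of the kernel, so [perp1] makes [x] no costlier. *)
Lemma norm1_le_cost (x : 'rV[R]_k) : perp1 x (kermx D) ->
  norm1 x <= \sum_i `|(x *m D) 0 i| * (dist (Some i))%:R.
Proof.
move=> x_perp; have /choice[y yD] : forall i, exists y,
    y *m D = delta_mx 0 i /\ norm1 y = (dist (Some i))%:R.
  by move=> i; have [y yD ny] := unit_flow i; exists y.
pose x' := \sum_i (x *m D) 0 i *: y i.
have x'D : x' *m D = x *m D.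
  rewrite mulmx_suml [RHS]row_sum_delta; apply: eq_bigr => i _.
  by rewrite -scalemxAl; have [-> _] := yD i.
have : norm1 x <= norm1 (x + (x' - x)).
  by apply: x_perp; rewrite sub_kermx mulmxBl x'D subrr.
rewrite addrC subrK => /le_trans; apply; apply: le_trans (norm1_sum _ _) _.
by apply: ler_sum => i _; rewrite norm1Z; have [_ ->] := yD i.
Qed.

(* The hypothesis on F stands in for the projection P: it does not change the
   1-norm of a relative coboundary expressed in the basis c. *)
Lemma cheeger_incidence n (F : 'M[R]_(k, n)) i :
    (forall x : 'rV_k, norm1 (x *m F) = norm1 (x *m D)) ->
    (forall j, (dist (Some j) <= dist (Some i))%N) ->
  is_minimum [set norm1 (x *m F) / norm1 x
    | x in [set x : 'rV[R]_k | x != 0 /\ perp1 x (kermx F)]]%classic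
    (1 / (dist (Some i))%:R).
Proof.
move=> FD i_max.
have kerE (y : 'rV_k) : (y <= kermx F)%MS = (y <= kermx D)%MS.
  by rewrite !sub_kermx -norm1_eq0 FD norm1_eq0.
have d_gt0 : 0 < (dist (Some i))%:R :> R by rewrite ltr0n dist_gt0.
split=> [|_ [x [x_neq0 x_perp] <-]].
  (* The minimum is attained at a cheapest unit flow from [i]. It satisfies [perp1] because adding a
     kernel element keeps the divergence, so the cost stays at least the distance. *)
  have [y yD ny] := unit_flow i; exists y; last by rewrite FD yD norm1_delta ny.
  split=> [|z]; first by rewrite -norm1_eq0 ny gt_eqF.
  rewrite kerE sub_kermx => /eqP zD; rewrite ny; apply: dist_le_norm1.
  by rewrite mulmxDl yD zD addr0.
have x_gt0 : 0 < norm1 x by rewrite lt_def norm1_eq0 x_neq0 norm1_ge0.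
rewrite FD ler_pdivrMr// mulrAC ler_pdivlMr// mul1r.
have {}x_perp : perp1 x (kermx D) by move=> y; rewrite -kerE; apply: x_perp.
apply: le_trans (norm1_le_cost x_perp) _; rewrite mulr_suml.
by apply: ler_sum => j _; rewrite ler_wpM2l ?normr_ge0// ler_nat i_max.
Qed.

End MinCostFlow.

(** * Disjoint indicator chains: contraction and projection *)

Section IndicatorBasis.
Context {R : realType} {m n : nat} (c : 'M[R]_(m, n)).
Hypothesis c01 : forall i j, c i j = 0 \/ c i j = 1.
Hypothesis c_disjoint : forall i i' j, i != i' -> c i j = 0 \/ c i' j = 0.

(** On graphs, this product contracts the support of each [c_i] to a vertex and everything outside
    the supports to the ground. An edge [x], [y] of [B] has entry [a * (cx i x - cx i y)] at [i],
    and each endpoint lies in at most one support. *)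
Lemma grounded_incidence_mul k (B : 'M[R]_(k, n)) :
  grounded_incidence B -> grounded_incidence (B *m c^T).
Proof.
move=> gB; pose cx i := grounded (row i c)^T.
have cx01 i x : cx i x = 0 \/ cx i x = 1.
  by rewrite /cx; case: x => [j|] /=; [rewrite !mxE|left].
have cx_disjoint i i' x : i != i' -> cx i x = 0 \/ cx i' x = 0.
  by rewrite /cx; case: x => [j|] /=; [rewrite !mxE; apply: c_disjoint|left].
have BcE r : (forall i, (B *m c^T) r i = 0) \/ exists a x y, `|a| = 1 /\
    forall i, (B *m c^T) r i = a * (cx i x - cx i y).
  have [Br0|[x [y xy]]] := row_edge r gB.
    by left=> i; rewrite mulmx_entry Br0 mul0mx mxE.
  have [a a1 Ba] := edge_row gB xy; right; exists a, x, y; split=> // i.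
  have -> : (B *m c^T) r i = (row r B *m (row i c)^T) 0 0.
    by rewrite !mxE; apply: eq_bigr => j _; rewrite !mxE.
  rewrite Ba /cx -scalemxAl mulmxBl -!vertex_chain_mul.
  by rewrite mxE [X in _ * X]mxE [X in _ + X]mxE.
split=> [r i|r i j ij].
  have [->|[a [x [y [a1 ->]]]]] := BcE r; first by rewrite eqxx.
  have [->|->] := cx01 i x; have [->|->] := cx01 i y;
    by rewrite ?subrr ?sub0r ?subr0 ?mulr0 ?mulrN ?normrN ?mulr1 ?eqxx ?a1.
have [->|[a [x [y [a1 aE]]]]] := BcE r; first by rewrite eqxx.
(* If both entries are nonzero, one endpoint lies in the support of [c_i] and the other in that of
   [c_j]; disjointness excludes all other cases. *)
rewrite !aE -mulrN => ni nj; congr (_ * _); move: ni nj.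
have := cx_disjoint _ _ x ij; have := cx_disjoint _ _ y ij.
have [->|->] := cx01 i x; have [->|->] := cx01 i y;
  have [->|->] := cx01 j x; have [->|->] := cx01 j y;
  rewrite ?subrr ?mulr0 ?eqxx ?sub0r ?subr0 ?opprK//;
  by move=> [] /eqP; rewrite ?oner_eq0// => _ [] /eqP; rewrite oner_eq0.
Qed.

Lemma mul_trmx_self_eq0 (v : 'rV[R]_n) : v *m v^T = 0 -> v = 0.
Proof.
move=> /matrixP/(_ 0 0)/eqP; rewrite !mxE psumr_eq0 => [/allP v0|j _].
  apply/rowP => j; have := v0 j (mem_index_enum j).
  by rewrite /= !mxE mulf_eq0 orbb => /eqP.
by rewrite mxE -expr2 sqr_ge0.
Qed.

Lemma norm_sum_indicators (v : 'rV[R]_m) j :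
  `|(v *m c) 0 j| = \sum_i `|v 0 i| * c i j.
Proof.
rewrite mxE; have [/existsP[i ci]|/existsPn c0] := boolP [exists i, c i j != 0].
  have others i' : i' != i -> c i' j = 0.
    by move=> /c_disjoint-/(_ j)[//|/eqP]; rewrite (negPf ci).
  rewrite (bigD1 i)// [in RHS](bigD1 i)//= !big1
    => [|i' /others->|i' /others->];
    rewrite ?mulr0// !addr0 normrM.
  by have [->|->] := c01 i j; rewrite ?normr0 ?normr1.
by rewrite !big1 ?normr0// => i _; move: (c0 i); rewrite negbK => /eqP ->;
  rewrite mulr0.
Qed.

(* Projecting on the span of the disjoint indicators c_i averages over the
   support of each c_i; the size of the support cancels in the 1-norm. *)
Lemma norm1_proj_indicators (U : 'M[R]_n) (g : 'rV[R]_n) :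
    (c == U)%MS -> row_free c ->
  norm1 (g *m proj_mx U (kermx U^T)) = norm1 (g *m c^T).
Proof.
move=> /andP[cU /submxP[M UE]] c_free; pose w i := \sum_j c i j.
have c_ge0 i j : 0 <= c i j by have [->|->] := c01 i j.
(* The weight [w i] is the size of the support of [c_i]; independence of the rows rules out an empty
   one. *)
have w_neq0 i : w i != 0.
  apply/eqP => /eqP; rewrite psumr_eq0// => /allP wi.
  have /rowP/(_ i) : delta_mx 0 i = 0 :> 'rV[R]_m.
    apply: (row_free_inj c_free); rewrite /= mul0mx -rowE; apply/rowP => j.
    by rewrite !mxE; apply/eqP/(wi j (mem_index_enum j)).
  by rewrite !mxE !eqxx => /eqP; rewrite oner_eq0.
have ccT : c *m c^T = diag_mx (\row_i w i).
  apply/matrixP => i i'; rewrite !mxE; have [<-|ii'] := eqVneq i i'.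
    rewrite mulr1n; apply: eq_bigr => j _; rewrite mxE.
    by have [->|->] := c01 i j; rewrite ?mulr0 ?mulr1.
  rewrite mulr0n big1// => j _; rewrite mxE.
  by have [->|->] := c_disjoint j ii'; rewrite ?mulr0 ?mul0r.
(* These are the means of [g] over the supports, the coordinates of its projection in the basis
   [c]. *)
pose v : 'rV_m := \row_i ((g *m c^T) 0 i / w i).
have capU : (U :&: kermx U^T)%MS = 0.
  apply/eqP; rewrite -submx0; apply/rV_subP => x; rewrite sub_capmx.
  move=> /andP[/submxP[a ->]]; rewrite sub_kermx => /eqP aU.
  rewrite (@mul_trmx_self_eq0 (a *m U)) ?sub0mx//.
  by rewrite trmx_mul mulmxA aU mul0mx.
have -> : g *m proj_mx U (kermx U^T) = v *m c.
  rewrite -[g in LHS](subrK (v *m c)) mulmxDl proj_mx_0// ?add0r.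
    by rewrite proj_mx_id// mulmx_sub.
  rewrite sub_kermx UE trmx_mul mulmxA mulmxBl -[v *m c *m _]mulmxA ccT.
  rewrite mul_mx_diag (_ : \matrix_(i, j) _ = g *m c^T) ?subrr ?mul0mx//.
  by apply/matrixP => i j; rewrite ord1 mxE [v _ _]mxE [X in _ * X]mxE divfK.
rewrite /norm1; under eq_bigr do rewrite norm_sum_indicators.
rewrite exchange_big /=; apply: eq_bigr => i _.
rewrite -mulr_sumr mxE normrM normfV [X in _ / X]ger0_norm ?divfK//.
exact: sumr_ge0.
Qed.

End IndicatorBasis.

(** * Boundary matrices of complexes and connectedness of the dual graph *)

Section Complexes.
Context {R : realType} {V : finType} (o : {set V} -> bool).
Context (K L : {set {set V}}) (q : nat).
Implicit Types s t : {set V}.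

Lemma norm_incidence s t :
  s \subset t -> #|t| = #|s|.+1 -> `|incidence o s t| = 1.
Proof.
move=> st ts; have /eqP/cards1P[v tsv] : #|t :\: s| = 1%N.
  by rewrite cardsD (setIidPr st) ts subSnn.
have [vs vt] : v \notin s /\ v \in t.
  by apply/andP; rewrite -in_setD tsv set11.
have tv : t :\ v = s.
  by rewrite -tsv finset.setDDr finset.setDv finset.set0U; apply/setIidPr.
rewrite /incidence (big_pred1 v) ?normrX ?normrN1 ?expr1n// => v' /=.
have [->|v'v] := eqVneq v' v; first by rewrite vt tv eqxx.
apply/negP => /andP[v't /eqP sE].
by move: vs; rewrite sE !inE vt eq_sym v'v.
Qed.

Lemma incidence_eq0 s t : ~~ (s \subset t) -> incidence o s t = 0.
Proof.
move=> st; rewrite /incidence big1// => v /andP[_ /eqP sE].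
by move: st; rewrite sE subsetDl.
Qed.

Hypothesis o_coherent : coherent_orientation o L q.

Lemma incidence_coface s t : s \in simplices L q -> t \in simplices L q.+1 ->
  ((incidence o s t)%:~R != 0 :> R) = (t \in cofaces L q s).
Proof.
rewrite !inE => /andP[_ /eqP sq] /[dup] tL /andP[_ /eqP tq]; rewrite tL /=.
have [st|st] := boolP (s \subset t).
  by rewrite intr_eq0 -normr_eq0 norm_incidence ?tq ?sq.
by rewrite incidence_eq0 ?eqxx.
Qed.

(** Coherence of [o] is the sign condition. Thus q-simplices act as edges of the dual graph of [L],
    those with a single coface leading to the ground. *)
Lemma grounded_incidence_bdmx (A : {set {set V}}) : A \subset simplices L q ->
  grounded_incidence (bdmx R o A (simplices L q.+1)).
Proof.
move=> /subsetP AL; split=> [r j|r j j' jj']; rewrite !mxE.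
  have sL := AL _ (enum_valP r).
  have tL := enum_valP j; rewrite incidence_coface// => tc.
  rewrite -intr_norm norm_incidence//; move: tc sL tL; rewrite !inE.
    by case/andP.
  by move=> _ /andP[_ /eqP->] /andP[_ /eqP->].
have sL := AL _ (enum_valP r).
rewrite !incidence_coface ?enum_valP// => tc tc'.
by rewrite (o_coherent sL tc tc') ?rmorphN// (inj_eq enum_val_inj).
Qed.

(** The coefficients of a cycle agree across every shared q-face. They vanish at [t0], the only
    coface of the boundary face [s0], hence everywhere by connectedness. *)
Lemma cycle_eq0 (w : 'cV[R]_#|simplices L q.+1|) :
    with_boundary L q -> dual_connected L q ->
  bdL R o L q *m w = 0 -> w = 0.
Proof.
move=> [s0 s0L /eqP/cards1P[t0 t0E]] L_connected w_cycle.
have gB := grounded_incidence_bdmx (subxx (simplices L q)).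
have t0L : t0 \in simplices L q.+1.
  by have := set11 t0; rewrite -t0E inE => /andP[].
have coface r j :
    (bdL R o L q r j != 0) = (enum_val j \in cofaces L q (enum_val r)).
  by rewrite mxE incidence_coface ?enum_valP.
(* The zero set of [w], taken in [{set V}] because [dual_adj] relates vertex sets, not indices; sets
   that are not (q+1)-simplices of [L] belong vacuously. *)
pose Z := [set t | [forall j, (enum_val j == t) ==> (w j 0 == 0)]]%SET.
have ZP j : (enum_val j \in Z) = (w j 0 == 0).
  rewrite inE; apply/forallP/idP => [/(_ j)|wj j']; first by rewrite eqxx.
  by apply/implyP => /eqP/enum_val_inj ->.
have t0Z : t0 \in Z.
  rewrite -(enum_rankK_in t0L t0L) ZP; apply/eqP.
  set j0 := enum_rank_in _ _.
  have j0E : enum_val j0 = t0 by apply: enum_rankK_in.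
  have := @edge_mul0 _ _ _ _ (enum_rank_in s0L s0) (Some j0) None w gB w_cycle.
  apply; apply/eqP/setP => j; rewrite !inE coface enum_rankK_in// t0E inE -j0E.
  by rewrite (inj_eq enum_val_inj).
have Z_closed : closed (dual_adj L q) Z.
  move=> t t' /and4P[tL t'L tt' /existsP[s /and3P[sL st st']]].
  rewrite -(enum_rankK_in tL tL) -(enum_rankK_in tL t'L) !ZP.
  set j := enum_rank_in _ t; set j' := enum_rank_in _ t'.
  have jE : enum_val j = t by apply: enum_rankK_in.
  have j'E : enum_val j' = t' by apply: enum_rankK_in.
  have jj' : j != j' by rewrite -(inj_eq enum_val_inj) jE j'E.
  have /= -> // :=
    @edge_mul0 _ _ _ _ (enum_rank_in sL s) (Some j) (Some j') w gB w_cycle.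
  rewrite jj'; apply: edge_support gB jj' _ _;
    by rewrite coface enum_rankK_in// ?jE ?j'E inE ?tL ?t'L.
apply/colP => j; rewrite mxE; apply/eqP; rewrite -ZP.
by rewrite -(closed_connect Z_closed (L_connected _ _ t0L (enum_valP j))).
Qed.

Context {m : nat} (c : 'M[R]_(m, #|simplices L q.+1|)).
Hypothesis K_sub_L : K \subset L.
Hypothesis c_basis : indicator_basis o K c.

Lemma simplicesS : simplices K q \subset simplices L q.
Proof. by apply/subsetP => s; rewrite !inE => /andP[/(subsetP K_sub_L)->]. Qed.

Lemma grounded_incidence_rel_bd : grounded_incidence (rel_bd o K c).
Proof.
case: c_basis => _ _ c01 c_disjoint; apply: grounded_incidence_mul => //.
exact/grounded_incidence_bdmx/simplicesS.
Qed.

(** The boundary of a relative chain already vanishes on q-simplices outside [K], which leaves only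
    the rows of [bdLK] to check. *)
Lemma bdL_mul_eq0 (w : 'rV[R]_#|simplices L q.+1|) :
    (w <= rel_chains R o K L q)%MS -> bdLK R o K L q *m w^T = 0 ->
  bdL R o L q *m w^T = 0.
Proof.
rewrite rel_chainsP => /submxP[a wE] wK; apply/colP => r; rewrite [RHS]mxE.
have [rK|rK] := boolP (enum_val r \in simplices K q); last first.
  transitivity ((w *m (bdL R o L q)^T) 0 r).
    by rewrite -[in RHS](trmxK w) -trmx_mul [RHS]mxE.
  rewrite wE mxE big1// => i _; rewrite mxE.
  have [iE|] := eqVneq (enum_val i) (enum_val r); last by rewrite mulr0.
  by move: rK; rewrite -iE enum_valP.
have /colP/(_ (enum_rank_in rK (enum_val r))) := wK.
rewrite [X in _ = X]mxE => <-.
by rewrite !mxE; apply: eq_bigr => j _; rewrite !mxE enum_rankK_in.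
Qed.

(** The indicator [z] of the vertices not connected to the ground is constant along edges, so [D]
    kills it. Hence the sum of the corresponding [c_i] is a cycle of [L], so it is 0, and
    independence of the [c_i] gives [z = 0]. *)
Lemma graph_connected i : with_boundary L q -> dual_connected L q ->
  connect (graph_adj (rel_bd o K c)) (Some i) None.
Proof.
move=> L_boundary L_connected; set G := graph_adj _.
have G_sym : connect_sym G.
  by apply: sym_connect_sym => x y; apply: graph_adj_sym.
pose z : 'cV[R]_m := \col_i (~~ connect G (Some i) None)%:R.
have zE x : grounded z x = (~~ connect G x None)%:R.
  by case: x => [j|] /=; rewrite ?mxE// connect0.
have Dz : rel_bd o K c *m z = 0.
  apply/colP => r; rewrite [RHS]mxE.
  have gD := grounded_incidence_rel_bd.
  have [Dr0|[x [y xy]]] := row_edge r gD.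
    by rewrite mulmx_entry Dr0 mul0mx mxE.
  have [a _ ->] := edge_mul z gD xy; rewrite !zE.
  have Gxy : connect G x y by apply/connect1/existsP; exists r.
  by rewrite (same_connect G_sym Gxy) subrr mulr0.
case: c_basis => /andP[c_rel _] c_free _ _.
have : (z^T *m c)^T = 0.
  apply: cycle_eq0 => //; apply: bdL_mul_eq0.
    exact: submx_trans (submxMl _ _) c_rel.
  by rewrite trmx_mul trmxK mulmxA.
move=> /(congr1 trmx); rewrite trmxK trmx0 -(mul0mx _ c).
move=> /(row_free_inj c_free)/rowP/(_ i); rewrite !mxE => /eqP.
by rewrite pnatr_eq0 eqb0 negbK.
Qed.

Lemma norm1_mul_PBt (x : 'rV[R]_#|simplices K q|) :
  norm1 (x *m PBt R o K L q) = norm1 (x *m rel_bd o K c).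
Proof.
case: c_basis => c_rel c_free c01 c_disjoint.
rewrite /PBt /rel_bd mulmxA [in RHS]mulmxA.
exact: (norm1_proj_indicators c01 c_disjoint _ c_rel c_free).
Qed.

End Complexes.

Lemma inf_is_minimum (R : realType) (A : set R) (a : R) :
  is_minimum A a -> inf A = a.
Proof.
move=> [Aa lba]; apply/eqP; rewrite eq_le lb_le_inf ?andbT//; last by exists a.
by rewrite ge_inf//; exists a.
Qed.

Unset Implicit Arguments.

Theorem proposition6p4 (R : realType) (V : finType) (K L : {set {set V}})
    (q : nat) (o : {set V} -> bool) (m : nat)
    (c : 'M[R]_(m, #|simplices L q.+1|))
    (K_complex : simplicial_complex K)
    (L_complex : simplicial_complex L)
    (K_sub_L : K \subset L)
    (L_pseudomanifold : orientable_pseudomanifold L q)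
    (L_boundary : with_boundary L q)
    (L_connected : dual_connected L q)
    (o_coherent : coherent_orientation o L q)
    (rel_neq0 : rel_chains R o K L q != 0)
    (c_basis : indicator_basis o K c) :
  let G := graph_adj (rel_bd o K c) in
  is_minimum (cheeger_quotients R o K L q) (cheeger R o K L q) /\
  is_minimum [set 1 / (graph_dist G (Some i) None)%:R | i in [set: 'I_m]]%classic
    (cheeger R o K L q).
Proof.
move=> G; set D := rel_bd o K c in G *.
(* Nonzero relative chains force [m > 0], so a farthest vertex exists. *)
have [i0] : exists i : 'I_m, true.
  case: m c c_basis @D @G => [|m'] c' [/eqmxP c_rel _ _ _]; last by exists ord0.
  by move: rel_neq0; rewrite -mxrank_eq0 -c_rel flatmx0 mxrank0.
have gD : grounded_incidence D :=
  grounded_incidence_rel_bd o_coherent K_sub_L c_basis.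
have D_connected i : connect G (Some i) None := graph_connected o_coherent
  K_sub_L c_basis i L_boundary L_connected.
case: (arg_maxnP (fun i => graph_dist G (Some i) None) (isT : xpredT i0)).
move=> i _ i_max.
have min_i := cheeger_incidence gD D_connected (norm1_mul_PBt c_basis)
  (fun j => i_max j isT).
rewrite /cheeger (inf_is_minimum min_i); split=> //.
split=> [|_ [j _ <-]]; first by exists i.
(* All distances are positive, so inversion reverses the order and the convention [1 / 0 = 0] never
   interferes. *)
rewrite !div1r lef_pV2 ?posrE ?ltr0n ?dist_gt0// ler_nat; exact: i_max.
Qed.
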